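(* Let $K$ be an infinite field of characteristic different from $2$ and $3$, and let $A=Ke\oplus U\oplus V$ be a Bernstein algebra over $K$ with $N=\ker\omega=U\oplus V$. The following conditions are equivalent: (i) $A$ is a locally train algebra; (ii) for all $v\in V$, the operators $L_v:U\to U$ are locally nilpotent; (iii) for all $v\in V$, the operators $L_v:L(A)\to L(A)$ are locally nilpotent; (iv) for all $x\in N$, the operators $L_x:N\to N$ are locally nilpotent.
   Context: Algebras are not assumed associative, unital or finite-dimensional. A Bernstein algebra over $K$ is a commutative $K$-algebra $A$ with a nonzero algebra homomorphism $\omega:A\to K$ satisfying $(x^2)^2=\omega(x)^2x^2$ for all $x$. Here $e$ is a nonzero idempotent of $A$ (necessarily $\omega(e)=1$) and $A=Ke\oplus U\oplus V$ is the Peirce decomposition: $U=\{u\in A:2eu=u\}$, $V=\{v\in A:ev=0\}$; one has $UV\subseteq U$. The Lyubich ideal is $L(A)=\{u\in U: uU=0\}$; it is an ideal of $A$ independent of $e$. $L_x$ denotes multiplication by $x$. An operator $f$ on a vector space $X$ is locally nilpotent if for every $x\in X$ there is $n$ (depending on $x$) with $f^n(x)=0$. Principal powers: $x^1=x$, $x^{k+1}=x^kx$. A commutative algebra with weight function $\omega$ is a train algebra if there are $r\ge2$ and $\gamma_1,\dots,\gamma_{r-1}\in K$ with $x^r+\gamma_1\omega(x)x^{r-1}+\cdots+\gamma_{r-1}\omega(x)^{r-1}x=0$ for all $x$; $A$ is locally train if for every $x$ with $\omega(x)=1$ the subalgebra generated by $x$ (with the restricted weight) is a train algebra. *)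

(* Defs.v *)
From HB Require Import structures.
From mathcomp Require Import all_boot all_order all_algebra.
From mathcomp Require Import boolp classical_sets functions cardinality.
Set Implicit Arguments.
Unset Strict Implicit.
Unset Printing Implicit Defensive.
Import GRing.Theory.
Local Open Scope classical_set_scope.
Local Open Scope ring_scope.

(* A nonassociative, nonunital algebra of arbitrary dimension is a vector space
   [A : lmodType K] together with a product [mul : {bilinear A -> A -> A}];
   the operator L_x is the partial application [mul x]. *)
Section Bernstein.
Variables (K : fieldType) (A : lmodType K) (mul : {bilinear A -> A -> A}).
Implicit Types (omega : {scalar A}) (S X : set A) (x y e u v : A).

Definition weight_function omega : Prop :=
  (exists x, omega x != 0) /\
  (forall x y, omega (mul x y) = omega x * omega y).

Definition bernstein_algebra omega : Prop :=
  [/\ commutative mul,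
      weight_function omega &
      forall x, mul (mul x x) (mul x x) = omega x ^+ 2 *: mul x x].

Definition nonzero_idempotent e : Prop := e != 0 /\ mul e e = e.

Definition peirceU e : set A := [set u | mul e u *+ 2 = u].

Definition peirceV e : set A := [set v | mul e v = 0].

Definition weight_kernel omega : set A := [set x | omega x = 0].

Definition lyubich_ideal e : set A :=
  [set u | peirceU e u /\ forall u', peirceU e u' -> mul u u' = 0].

(* In every use below [X] is a subspace mapped into itself by [f]. *)
Definition locally_nilpotent X (f : A -> A) : Prop :=
  forall x, X x -> exists n : nat, iter n f x = 0.

Definition subalgebra S : Prop :=
  [/\ S 0,
      forall (a : K) x y, S x -> S y -> S (a *: x + y) &
      forall x y, S x -> S y -> S (mul x y)].

Definition generated_subalgebra x : set A := smallest subalgebra [set x].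

(* Principal powers: [ppow x 1 = x] and [ppow x k.+2 = mul (ppow x k.+1) x].
   There is no unit, so the value at exponent 0 is meaningless (it is [x]);
   only positive exponents occur below. *)
Definition ppow x (k : nat) : A := iter k.-1 (fun y => mul y x) x.

(* The subalgebra [S], with the restriction of [omega], is a train algebra. *)
Definition train_algebra omega S : Prop :=
  exists (r : nat) (gamma : nat -> K), (2 <= r)%N /\
    forall x, S x ->
      ppow x r +
        \sum_(1 <= i < r) (gamma i * omega x ^+ i) *: ppow x (r - i)%N = 0.

Definition locally_train_algebra omega : Prop :=
  forall x, omega x = 1 -> train_algebra omega (generated_subalgebra x).

End Bernstein.

(* Main.v *)
(* Polarizing (x^2)^2 = omega(x)^2 x^2 yields the multiplication rules of the
   Peirce components, in particular u(u'v) = -u'(uv), u(vv') = 0 and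
   (uv)(u'v) = 0; hence V^2 and L_v^2(U) lie in L = L(A).

   (i) => (ii): for x = e + u + v + u^2, the element n = x - x^2 = v + b, with b
   in U, lies in the kernel of omega on the subalgebra generated by x, so it is
   nil; its powers are n^(k+2) = L_v^k(v^2 + 2vb).  Subtracting the resulting
   relations for u and -u leaves L_v^(k+2)(u) = 0 for some k.

   (iii) => (iv): (xy)z + (yz)x + (zx)y lies in L for x, y, z in N, which forces
   L_x^3(N) to lie in L, and L_x = L_v on L when x = u + v.

   (iv) => (i): take e = x^2 as the idempotent, so that x = e + u + v with u^2 = 0
   and u = - v^2 - 2uv in L.  The subalgebra generated by x lies in Ke + Kv + M,
   where M is the space of the l in L killed by a fixed power L_v^m that kills
   u and v^2.  For y in it, y(y^2 - omega(y)y) lies in M and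
   (L_y - omega(y)/2)^m kills M, so X^2(X - 1)(X - 1/2)^m gives a train
   equation. *)

Require Import Defs.
From mathcomp Require Import all_boot all_order all_algebra.
From mathcomp Require Import boolp classical_sets functions cardinality.
From mathcomp Require Import ring.
Import GRing.Theory.
Local Open Scope classical_set_scope.
Local Open Scope ring_scope.

(** * Linear identities by comparison of coefficients *)

(** Syntax of linear combinations, for a proof by reflection. [LVar i] is the i-th entry of a list
    of atoms; every product of vectors counts as an atom. *)
Inductive lmod_expr (K : Type) : Type :=
  | LVar of nat
  | LZero
  | LAdd of lmod_expr K & lmod_expr K
  | LOpp of lmod_expr K
  | LScale of K & lmod_expr K
  | LMuln of lmod_expr K & nat.

Arguments LVar {K} _.
Arguments LZero {K}.

Fixpoint lmod_eval (K : comNzRingType) (A : lmodType K) (s : seq A)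
    (t : lmod_expr K) : A :=
  match t with
  | LVar i => s`_i
  | LZero => 0
  | LAdd t1 t2 => lmod_eval K A s t1 + lmod_eval K A s t2
  | LOpp t1 => - lmod_eval K A s t1
  | LScale k t1 => k *: lmod_eval K A s t1
  | LMuln t1 n => lmod_eval K A s t1 *+ n
  end.

Fixpoint lmod_coef (K : comNzRingType) (i : nat) (t : lmod_expr K) : K :=
  match t with
  | LVar j => if Nat.eqb i j then 1 else 0
  | LZero => 0
  | LAdd t1 t2 => lmod_coef K i t1 + lmod_coef K i t2
  | LOpp t1 => - lmod_coef K i t1
  | LScale k t1 => k * lmod_coef K i t1
  | LMuln t1 n => lmod_coef K i t1 *+ n
  end.

Fixpoint lmod_agree (K : comNzRingType) (n : nat) (t1 t2 : lmod_expr K) : Prop :=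
  match n with
  | 0%N => True
  | S i => lmod_coef K i t1 = lmod_coef K i t2 /\ lmod_agree K i t1 t2
  end.

Lemma lmod_evalE (K : comNzRingType) (A : lmodType K) (s : seq A) t :
  lmod_eval K A s t = \sum_(i < size s) lmod_coef K i t *: s`_i.
Proof.
elim: t => /= [j||t1 -> t2 ->|t ->|k t ->|t -> n].
- have [lt_js|le_sj] := ltnP j (size s).
    rewrite (bigD1 (Ordinal lt_js)) //= PeanoNat.Nat.eqb_refl scale1r big1 ?addr0 //.
    move=> i; rewrite -val_eqE /= => /eqP neq_ij.
    by case: (PeanoNat.Nat.eqb_spec i j) => // _; rewrite scale0r.
  rewrite nth_default // big1 // => i _.
  case: (PeanoNat.Nat.eqb_spec i j) => [eq_ij|_]; last by rewrite scale0r.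
  by have := ltn_ord i; rewrite eq_ij ltnNge le_sj.
- by rewrite big1 // => i _; rewrite scale0r.
- by rewrite -big_split; apply: eq_bigr => i _; rewrite scalerDl.
- by rewrite -sumrN; apply: eq_bigr => i _; rewrite scaleNr.
- by rewrite scaler_sumr; apply: eq_bigr => i _; rewrite scalerA.
- by rewrite -sumrMnl; apply: eq_bigr => i _; rewrite scalerMnl.
Qed.

Lemma lmod_eval_eq (K : comNzRingType) (A : lmodType K) (s : seq A) t1 t2 :
  lmod_agree K (size s) t1 t2 -> lmod_eval K A s t1 = lmod_eval K A s t2.
Proof.
rewrite !lmod_evalE => agree; apply: eq_bigr => -[i lt_is] _ /=; congr (_ *: _).
elim: (size s) agree lt_is => //= n IHn [eq_n agree].
by rewrite ltnS leq_eqVlt => /predU1P[-> //|]; apply: IHn.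
Qed.

Ltac lmod_index x s :=
  lazymatch s with
  | x :: _ => constr:(0%N)
  | _ :: ?s' => let i := lmod_index x s' in constr:(S i)
  end.

Ltac lmod_atoms x s :=
  lazymatch x with
  | (?y + ?z)%R => let s := lmod_atoms y s in lmod_atoms z s
  | (- ?y)%R => lmod_atoms y s
  | (_ *: ?y)%R => lmod_atoms y s
  | (?y *+ _)%R => lmod_atoms y s
  | 0%R => s
  | _ => match s with
         | _ => let _ := lmod_index x s in s
         | _ => constr:(x :: s)
         end
  end.

Ltac lmod_reify K x s :=
  lazymatch x with
  | (?y + ?z)%R =>
      let t1 := lmod_reify K y s in
      let t2 := lmod_reify K z s in constr:(LAdd K t1 t2)
  | (- ?y)%R => let t := lmod_reify K y s in constr:(LOpp K t)
  | (?k *: ?y)%R => let t := lmod_reify K y s in constr:(LScale K k t)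
  | (?y *+ ?n)%R => let t := lmod_reify K y s in constr:(LMuln K t n)
  | 0%R => constr:(@LZero K)
  | _ => let i := lmod_index x s in constr:(@LVar K i)
  end.

(** Reduces a vector identity to one scalar identity per atom, left to [ring]. Atoms are matched
    syntactically, so commuted products have to be brought to one form beforehand. *)
Ltac lmod :=
  lazymatch goal with
  | A : @GRing.Lmodule.type (GRing_Field__to__GRing_PzRing ?K) |- @eq _ ?x ?y =>
      let s := lmod_atoms x (@nil (GRing.Lmodule.sort A)) in
      let s := lmod_atoms y s in
      let t1 := lmod_reify (GRing.Field.sort K) x s in
      let t2 := lmod_reify (GRing.Field.sort K) y s in
      change (lmod_eval K A s t1 = lmod_eval K A s t2);
      apply: lmod_eval_eq;
      cbv [lmod_agree lmod_coef size Nat.eqb];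
      repeat split; ring
  end.

(** * Polarization *)

Section Polarization.
Variables (K : fieldType) (A : lmodType K) (F : A -> A -> A -> A -> A).
Hypothesis F_swap12 : forall a b c d, F a b c d = F b a c d.
Hypothesis F_swap23 : forall a b c d, F a b c d = F a c b d.
Hypothesis F_swap34 : forall a b c d, F a b c d = F a b d c.
Hypothesis F_linear4 :
  forall a b c d k d', F a b c (d + k *: d') = F a b c d + k *: F a b c d'.

Let F_linear3 a b c k c' d :
  F a b (c + k *: c') d = F a b c d + k *: F a b c' d.
Proof. by rewrite F_swap34 F_linear4 !(F_swap34 _ _ d). Qed.

Let F_linear2 a b k b' c d :
  F a (b + k *: b') c d = F a b c d + k *: F a b' c d.
Proof. by rewrite F_swap23 F_linear3 !(F_swap23 _ c). Qed.

Let F_linear1 a k a' b c d :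
  F (a + k *: a') b c d = F a b c d + k *: F a' b c d.
Proof. by rewrite F_swap12 F_linear2 !(F_swap12 b). Qed.

Let F_linear := (F_linear1, F_linear2, F_linear3, F_linear4).

(** The variables are freed one at a time, by evaluating at sums a + kb with k among 1, -1 and 2.
    Every division is by 2 or 3. *)
Lemma symmetric_quadrilinear_eq0 :
    (2%:R != 0 :> K) -> (3%:R != 0 :> K) ->
  (forall a, F a a a a = 0) -> forall a b c d, F a b c d = 0.
Proof.
move=> K2 K3 F_diag.
have regular n x : (n%:R != 0 :> K) -> n%:R *: x = 0 :> A -> x = 0.
  by move=> n_neq0 /eqP; rewrite scaler_eq0 (negPf n_neq0) => /eqP.
have F_cubic a b : F a b b b = 0.
  have expand k : k%:~R *: (4 *: F a a a b + (6 * k%:~R) *: F a a b b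
                          + (4 * k%:~R ^+ 2) *: F a b b b) = 0.
    rewrite -[RHS](F_diag (a + k%:~R *: b)) !F_linear !F_diag.
    (* Sorting the arguments by symmetry makes equal values syntactically equal for [lmod]. *)
    rewrite !(F_swap12 b a) !(F_swap23 _ b a) !(F_swap12 b a).
    by rewrite !(F_swap34 _ _ b a) !(F_swap23 _ b a) !(F_swap12 b a); lmod.
  apply: (regular 2%N) => //; apply: (regular 2%N) => //.
  apply: (regular 2%N) => //; apply: (regular 3%N) => //.
  (* Writing E(k) for the expansion, E(2) - 3E(1) - E(-1) eliminates the two mixed terms and leaves
     24 F(a,b,b,b), where 24 = 2 * 2 * 2 * 3. *)
  rewrite -[RHS](addr0) -{1}(expand 2) -[X in _ = _ + X](scaler0 A (- 3)).
  rewrite -{1}(expand 1) -[RHS]subr0 -{1}(expand (-1)).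
  by lmod.
have F_square a b c : F a b c c = 0.
  have expand k : k%:~R *: (F a b b c *+ 3 + (3 * k%:~R) *: F a b c c) = 0.
    rewrite -[RHS](F_cubic a (b + k%:~R *: c)) !F_linear !F_cubic.
    by rewrite !(F_swap23 a c b) !(F_swap34 _ _ c b) !(F_swap23 a c b); lmod.
  apply: (regular 2%N) => //; apply: (regular 3%N) => //.
  (* The sum of the expansions at 1 and -1 is 6 F(a,b,c,c). *)
  rewrite -[RHS](addr0) -{1}(expand 1) -(expand (-1)).
  by lmod.
move=> a b c d; apply: (regular 2%N) => //.
rewrite -[RHS](F_square a b (c + 1 *: d)) !F_linear !F_square (F_swap34 a b d c).
by lmod.
Qed.

End Polarization.

(** * Bernstein algebras *)

Section BernsteinAlgebra.
Variables (K : fieldType) (A : lmodType K) (mul : {bilinear A -> A -> A}).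
Variable omega : {scalar A}.
Hypothesis char_not2 : 2%N \notin [pchar K].
Hypothesis char_not3 : 3%N \notin [pchar K].
Hypothesis A_bernstein : bernstein_algebra mul omega.

Local Notation "x ** y" := (mul x y) (at level 29, left associativity).

Let two_neq0 : 2%:R != 0 :> K.
Proof. by apply: contra char_not2 => two0; rewrite inE /= two0. Qed.

Let three_neq0 : 3%:R != 0 :> K.
Proof. by apply: contra char_not3 => three0; rewrite inE /= three0. Qed.

Let mulC x y : x ** y = y ** x.
Proof. by case: A_bernstein. Qed.

Let omegaM x y : omega (x ** y) = omega x * omega y.
Proof. by case: A_bernstein => _ []. Qed.

Let bernstein x : (x ** x) ** (x ** x) = omega x ^+ 2 *: (x ** x).
Proof. by case: A_bernstein. Qed.

Let mulDl x y z : (x + y) ** z = x ** z + y ** z.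
Proof. exact: linearDl. Qed.
Let mulDr x y z : x ** (y + z) = x ** y + x ** z.
Proof. exact: linearDr. Qed.
Let mulNl x y : (- x) ** y = - (x ** y).
Proof. exact: linearNl. Qed.
Let mulNr x y : x ** (- y) = - (x ** y).
Proof. exact: linearNr. Qed.
Let mulZl k x y : (k *: x) ** y = k *: (x ** y).
Proof. exact: linearZl_LR. Qed.
Let mulZr k x y : x ** (k *: y) = k *: (x ** y).
Proof. exact: linearZr_LR. Qed.
Let mulMnl x y n : (x *+ n) ** y = (x ** y) *+ n.
Proof. exact: linearMnl. Qed.
Let mulMnr x y n : x ** (y *+ n) = (x ** y) *+ n.
Proof. exact: linearMnr. Qed.
Let mul0x x : 0 ** x = 0.
Proof. exact: linear0l. Qed.
Let mulx0 x : x ** 0 = 0.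
Proof. exact: linear0r. Qed.

(* The rules for [*+] come first because [x *+ 2] unifies with [x + x]. *)
Let mulE :=
  (mulMnl, mulMnr, mulZl, mulZr, mulNl, mulNr, mulDl, mulDr, mul0x, mulx0).

Let mulrn2_inj (x : A) : x *+ 2 = 0 -> x = 0.
Proof.
by move/eqP; rewrite -scaler_nat scaler_eq0 (negPf two_neq0) => /eqP.
Qed.

Let mulrn3_inj (x : A) : x *+ 3 = 0 -> x = 0.
Proof.
by move/eqP; rewrite -scaler_nat scaler_eq0 (negPf three_neq0) => /eqP.
Qed.

Let half_inj (x : A) : 2^-1 *: x = 0 -> x = 0.
Proof.
by move/eqP; rewrite scaler_eq0 invr_eq0 (negPf two_neq0) => /eqP.
Qed.

(* One quarter of the full linearization of (x^2)^2 - omega(x)^2 x^2. *)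
Definition bernstein_form a b c d : A :=
  (a ** b ** (c ** d) + a ** c ** (b ** d) + a ** d ** (b ** c)) *+ 2
  - ((omega a * omega b) *: (c ** d) + (omega a * omega c) *: (b ** d)
     + (omega a * omega d) *: (b ** c) + (omega b * omega c) *: (a ** d)
     + (omega b * omega d) *: (a ** c) + (omega c * omega d) *: (a ** b)).

(** On the diagonal the form is six times (x^2)^2 - omega(x)^2 x^2, so polarization applies. *)
Lemma bernstein_form_eq0 a b c d : bernstein_form a b c d = 0.
Proof.
apply: symmetric_quadrilinear_eq0 => // {a b c d}; rewrite /bernstein_form.
- by move=> a b c d; rewrite (mulC b a) (mulC (b ** c)) (mulC (b ** d)); lmod.
- by move=> a b c d; rewrite (mulC c b); lmod.
- by move=> a b c d; rewrite (mulC d c); lmod.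
- move=> a b c d k d'.
  have -> : omega (d + k *: d') = omega d + k * omega d'.
    by rewrite linearD linearZ.
  by rewrite !mulE; lmod.
- by move=> a; rewrite bernstein; lmod.
Qed.

Lemma weight_kernelM x y :
  weight_kernel omega x -> weight_kernel omega (x ** y).
Proof. by rewrite /weight_kernel /= omegaM => ->; rewrite mul0r. Qed.

Lemma kernel_mulM a b c d :
    weight_kernel omega a -> weight_kernel omega b ->
    weight_kernel omega c -> weight_kernel omega d ->
  a ** b ** (c ** d) + a ** c ** (b ** d) + a ** d ** (b ** c) = 0.
Proof.
move=> a0 b0 c0 d0; apply: mulrn2_inj.
by rewrite -[RHS](bernstein_form_eq0 a b c d) /bernstein_form a0 b0 c0 d0; lmod.
Qed.

(** * Peirce decomposition and its multiplication rules *)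

Section Peirce.
Variable e : A.
Hypothesis e_idempotent : nonzero_idempotent mul e.

Local Notation U := (peirceU mul e).
Local Notation V := (peirceV mul e).
Local Notation N := (weight_kernel omega).
Local Notation L := (lyubich_ideal mul e).

Let ee : e ** e = e. Proof. by case: e_idempotent. Qed.

(** Were omega(e) = 0, the Bernstein identity at e would force e = 0. *)
Lemma omega_idempotent : omega e = 1.
Proof.
have : omega e * omega e = omega e by rewrite -omegaM ee.
have [e0|/mulfI inj_e] := eqVneq (omega e) 0; last first.
  by rewrite -[RHS]mulr1 => /inj_e.
have := bernstein e; rewrite !ee e0 expr0n /= scale0r.
by case: e_idempotent => /eqP.
Qed.

Lemma peirceUE u : U u -> e ** u = 2^-1 *: u.
Proof. by move=> {2}<-; rewrite -scaler_nat scalerA mulVf ?scale1r. Qed.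

Lemma peirceU_kernel u : U u -> N u.
Proof.
move=> uU; have : omega (e ** u *+ 2) = omega u by rewrite uU.
rewrite linearMn /= omegaM omega_idempotent mul1r mulr2n => /eqP.
by rewrite -subr_eq0 addrK => /eqP.
Qed.

Lemma peirceV_kernel v : V v -> N v.
Proof.
move=> vV; have : omega (e ** v) = 0 by rewrite vV linear0.
by rewrite omegaM omega_idempotent mul1r.
Qed.

(** The form at (e, e, a, b). It decides in which Peirce component U^2, UV and V^2 lie. *)
Lemma kernel_mul_idempotent a b :
  N a -> N b -> (e ** (a ** b) + e ** a ** (e ** b) *+ 2) *+ 2 = a ** b.
Proof.
move=> a0 b0; rewrite -[RHS]addr0 -(bernstein_form_eq0 e e a b).
rewrite /bernstein_form a0 b0 omega_idempotent ee (mulC (e ** b) (e ** a)).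
by lmod.
Qed.

(** The form at (e, a, b, c). As e acts by 1/2 on U and by 0 on V, it yields the rules for triple
    products. *)
Lemma kernel_cyclic a b c : N a -> N b -> N c ->
  e ** a ** (b ** c) + e ** b ** (a ** c) + e ** c ** (a ** b) = 0.
Proof.
move=> a0 b0 c0; apply: mulrn2_inj.
by rewrite -[RHS](bernstein_form_eq0 e a b c) /bernstein_form a0 b0 c0; lmod.
Qed.

(** The form at (e, e, e, x) gives 2 e(ex) = ex, so 2 L_e is a projection on N, with image U and
    kernel V. *)
Lemma peirce_decomposition x : N x -> exists u v, [/\ U u, V v & x = u + v].
Proof.
move=> x0; exists (e ** x *+ 2), (x - e ** x *+ 2).
have eex : e ** (e ** x) *+ 2 = e ** x.
  apply/eqP; rewrite -subr_eq0; apply/eqP/mulrn3_inj.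
  rewrite -[RHS](bernstein_form_eq0 e e e x) /bernstein_form.
  by rewrite x0 omega_idempotent !ee (mulC (e ** x) e); lmod.
split; last by lmod.
- by rewrite /peirceU /= mulE eex.
- by rewrite /peirceV /= !mulE eex subrr.
Qed.

Lemma peirce_disjoint x : U x -> V x -> x = 0.
Proof. by move=> xU xV; rewrite -xU xV mul0rn. Qed.

Lemma peirceUD x y : U x -> U y -> U (x + y).
Proof. by rewrite /peirceU /= mulE mulrnDl => -> ->. Qed.

Lemma peirceUZ k x : U x -> U (k *: x).
Proof. by rewrite /peirceU /= mulE scalerMnr => ->. Qed.

Lemma peirceVD x y : V x -> V y -> V (x + y).
Proof. by rewrite /peirceV /= mulE => -> ->; rewrite addr0. Qed.

Lemma mulUU u u' : U u -> U u' -> V (u ** u').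
Proof.
move=> uU u'U; rewrite /peirceV /=; apply: mulrn2_inj.
have := kernel_mul_idempotent u u' (peirceU_kernel u uU) (peirceU_kernel u' u'U).
have eueu' : e ** u ** (e ** u') *+ 4 = u ** u'.
  by rewrite -[in RHS]uU -[in RHS]u'U !mulE; lmod.
move=> mul_e; apply: (addIr (e ** u ** (e ** u') *+ 4)).
by rewrite add0r [RHS]eueu' -[RHS]mul_e; lmod.
Qed.

Lemma mulUV u v : U u -> V v -> U (u ** v).
Proof.
move=> uU vV.
have := kernel_mul_idempotent u v (peirceU_kernel u uU) (peirceV_kernel v vV).
by rewrite vV mulx0 mul0rn addr0.
Qed.

Lemma mulVU v u : V v -> U u -> U (v ** u).
Proof. by move=> vV uU; rewrite mulC; apply: mulUV. Qed.

Lemma mulVV v v' : V v -> V v' -> U (v ** v').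
Proof.
move=> vV v'V.
have := kernel_mul_idempotent v v' (peirceV_kernel v vV) (peirceV_kernel v' v'V).
by rewrite vV mul0x mul0rn addr0.
Qed.

Hint Resolve peirceU_kernel peirceV_kernel mulUU mulUV mulVU mulVV : core.

Lemma mulU_UU a b c : U a -> U b -> U c ->
  a ** (b ** c) + b ** (a ** c) + c ** (a ** b) = 0.
Proof.
move=> aU bU cU; apply: half_inj; rewrite !scalerDr -!mulZl -!peirceUE //.
by apply: kernel_cyclic; apply: peirceU_kernel.
Qed.

Lemma mulU_UV a b v : U a -> U b -> V v -> a ** (v ** b) = - (v ** a ** b).
Proof.
move=> aU bU vV; apply/eqP; rewrite -subr_eq0 opprK; apply/eqP.
apply: half_inj; rewrite scalerDr.
rewrite (mulC (v ** a)) -!mulZl -!peirceUE // (mulC v a) (mulC v b).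
have := kernel_cyclic a b v (peirceU_kernel a aU) (peirceU_kernel b bU) (peirceV_kernel v vV).
by rewrite vV mul0x addr0.
Qed.

Lemma mulU_VV a v v' : U a -> V v -> V v' -> a ** (v ** v') = 0.
Proof.
move=> aU vV v'V; apply: half_inj; rewrite -mulZl -peirceUE //.
have := kernel_cyclic a v v' (peirceU_kernel a aU) (peirceV_kernel v vV) (peirceV_kernel v' v'V).
by rewrite vV v'V !mul0x !addr0.
Qed.

(** [kernel_mulM] equates the sum of the two products, which lies in U^2 and so in V, with
    -(ab)(vv'), which lies in VU and so in U. Both are therefore zero. *)
Lemma mulUV_UV a b v v' : U a -> U b -> V v -> V v' ->
  v ** a ** (v' ** b) = - (v' ** a ** (v ** b)).
Proof.
move=> aU bU vV v'V; apply/eqP; rewrite -subr_eq0 opprK; apply/eqP.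
have E := kernel_mulM a b v v' (peirceU_kernel a aU) (peirceU_kernel b bU)
  (peirceV_kernel v vV) (peirceV_kernel v' v'V).
apply: peirce_disjoint; last by apply: peirceVD; auto.
have -> : v ** a ** (v' ** b) + v' ** a ** (v ** b) = (-1) *: (a ** b ** (v ** v')).
  apply/eqP; rewrite -subr_eq0 -{1}E; apply/eqP.
  rewrite !(mulC a) (mulC b v') (mulC b v); lmod.
by apply: peirceUZ; auto.
Qed.

Lemma mulUV_UV0 a b v : U a -> U b -> V v -> v ** a ** (v ** b) = 0.
Proof.
move=> aU bU vV; apply: mulrn2_inj.
by rewrite mulr2n {1}mulUV_UV // addNr.
Qed.

Lemma mulU_sqrU u : U u -> u ** (u ** u) = 0.
Proof.
move=> uU; have /eqP := mulU_UU u u u uU uU uU.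
have -> : u ** (u ** u) + u ** (u ** u) + u ** (u ** u) = 3%:R *: (u ** (u ** u)) by lmod.
by rewrite scaler_eq0 (negPf three_neq0) => /eqP.
Qed.

Lemma mul_sqrUU u : U u -> u ** u ** (u ** u) = 0.
Proof.
move=> uU; have u0 := peirceU_kernel u uU.
by rewrite bernstein u0 expr0n scale0r.
Qed.

(** * The Lyubich ideal *)

Lemma lyubich0 : L 0.
Proof. by split=> [|u _]; rewrite /peirceU /= mulE ?mul0rn. Qed.

Lemma lyubichD x y : L x -> L y -> L (x + y).
Proof.
move=> [xU x0] [yU y0]; split=> [|u uU]; first exact: peirceUD.
by rewrite mulE x0 ?y0 ?addr0.
Qed.

Lemma lyubichZ k x : L x -> L (k *: x).
Proof.
move=> [xU x0]; split=> [|u uU]; first exact: peirceUZ.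
by rewrite mulE x0 ?scaler0.
Qed.

Lemma lyubichUl l u : L l -> U u -> u ** l = 0.
Proof. by case=> _ l0 uU; rewrite mulC l0. Qed.

Lemma lyubichVl l v : L l -> V v -> L (v ** l).
Proof.
move=> [lU l0] vV; split=> [|u uU]; first exact: mulVU.
by rewrite mulC mulU_UV // mulC l0 ?oppr0; auto.
Qed.

Lemma lyubich_kernell l x : L l -> N x -> L (x ** l).
Proof.
move=> lL /peirce_decomposition[u [v [uU vV ->]]].
by rewrite mulE lyubichUl // add0r; apply: lyubichVl.
Qed.

Lemma lyubichVV v v' : V v -> V v' -> L (v ** v').
Proof. by move=> vV v'V; split=> [|u uU]; [auto | rewrite mulC mulU_VV]. Qed.

Lemma lyubich_sqrV u v : U u -> V v -> L (v ** (v ** u)).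
Proof.
move=> uU vV; split=> [|u' u'U]; first by auto.
by rewrite mulC mulU_UV ?mulUV_UV0 ?oppr0 //; auto.
Qed.

(** * Iterates of L_v and principal powers *)

Lemma iter_mul_linear k v a x y :
  iter k (mul v) (a *: x + y) = a *: iter k (mul v) x + iter k (mul v) y.
Proof. by elim: k => //= k ->; rewrite !mulE. Qed.

Lemma iter_mul0 k v : iter k (mul v) 0 = 0.
Proof. by elim: k => //= k ->; rewrite mulx0. Qed.

Lemma iter_mul_eq0 k n v x :
  (k <= n)%N -> iter k (mul v) x = 0 -> iter n (mul v) x = 0.
Proof. by move=> /subnK <- xk; rewrite iterD xk iter_mul0. Qed.

Lemma iter_mulU k v u : V v -> U u -> U (iter k (mul v) u).
Proof. by move=> vV uU; elim: k => //= k IHk; apply: mulVU. Qed.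

Lemma iter_mulL k v l : V v -> L l -> L (iter k (mul v) l).
Proof. by move=> vV lL; elim: k => //= k IHk; apply: lyubichVl. Qed.

(* Moving one factor [v] across the product changes the sign, so every such
   product reduces to the case where the two exponents differ by 0 or 1. *)
Lemma mul_iter_iter v c d i : V v -> U c -> (0 < i + d)%N ->
  iter i (mul v) c ** iter (i + d) (mul v) c = 0.
Proof.
move=> vV cU; have iterU j : U (iter j (mul v) c) by apply: iter_mulU.
elim/ltn_ind: d i => -[|[|d]] IHd i id_gt0.
- by case: i id_gt0 => // i _; rewrite addn0 /= mulUV_UV0.
- apply: mulrn2_inj; rewrite addn1 /= mulr2n {1}mulU_UV //.
  by rewrite (mulC (iter i _ _)) addNr.
- rewrite addnS /= mulU_UV //; rewrite -[v ** iter i _ _]/(iter i.+1 (mul v) c).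
  by rewrite addnS -addSn IHd ?oppr0.
Qed.

(** Multiplication by b kills every power from the second on: b L_v^(k+1)(b) = 0 by [mul_iter_iter],
    and L_v^k(v^2) lies in L. Only the factor v contributes. *)
Lemma ppow_VU v b k : V v -> U b -> b ** b = 0 ->
  ppow mul (v + b) k.+2 = iter k (mul v) (v ** v + v ** b *+ 2).
Proof.
move=> vV bU bb; rewrite /ppow /=.
elim: k => [|k IHk] /=; first by rewrite !mulE bb (mulC b v); lmod.
rewrite {}IHk mulC mulDl.
have -> : v ** v + v ** b *+ 2 = 2 *: (v ** b) + v ** v by lmod.
rewrite iter_mul_linear [b ** _]mulDr mulZr -iterSr.
rewrite (mul_iter_iter v b k.+1 0) // scaler0.
have iterL : L (iter k (mul v) (v ** v)) by apply: iter_mulL => //; apply: lyubichVV.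
by rewrite (lyubichUl _ b iterL) // !addr0.
Qed.

(** * Locally train implies nilpotency on U *)

Lemma generated_subalgebraP x : subalgebra mul (generated_subalgebra mul x).
Proof.
split=> [|k y z yS zS|y z yS zS] B BP; have [[B0 B_lin B_mul] _] := BP => //.
- by apply: B_lin; [apply: yS BP | apply: zS BP].
- by apply: B_mul; [apply: yS BP | apply: zS BP].
Qed.

(** At weight zero only the leading term x^r of the train equation survives, and r >= 2 can be
    written k + 2. *)
Lemma train_kernel_nil S : train_algebra mul omega S ->
  exists k, forall x, S x -> N x -> ppow mul x k.+2 = 0.
Proof.
case=> -[|[|k]] [gamma []] // _ train; exists k => x xS x0.
have := train x xS; rewrite big_nat big1 ?addr0 // => i /andP[i_gt0 _].
by rewrite x0 expr0n -[i]prednK //= mulr0 scale0r.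
Qed.

(** The vector is v^2 + 2vb, where v + b = x - x^2 for x = e + u + v + u^2. The summand u^2 of x
    cancels the one in x^2, so that the V-component of x - x^2 is exactly v. *)
Lemma locally_train_iter u v : locally_train_algebra mul omega ->
  U u -> V v -> exists k, iter k (mul v)
    (v ** v - v ** (v ** v) *+ 2 - v ** (v ** (u ** u)) *+ 4
     - v ** (v ** u) *+ 4) = 0.
Proof.
move=> train uU vV; set x := e + u + v + u ** u.
have uuV : V (u ** u) by apply: mulUU.
have x1 : omega x = 1.
  rewrite /x !linearD /= omega_idempotent (peirceU_kernel u) //.
  by rewrite (peirceV_kernel v) // (peirceV_kernel (u ** u)) // !addr0.
pose b := - (v ** u *+ 2 + v ** v + v ** (u ** u) *+ 2).
have vbE : x - x ** x = v + b.
  rewrite /x /b !mulE (mulC u e) (mulC v e) (mulC (u ** u) e).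
  rewrite (mulC u v) (mulC (u ** u) v) (mulC (u ** u) u) mulU_sqrU // ee.
  have eu0 : e ** u *+ 2 - u = 0 by rewrite uU subrr.
  by rewrite mul_sqrUU // vV uuV -[LHS]addr0 -[X in _ + X = _]eu0; lmod.
have bE : b = - (2 *: (v ** u) + (v ** v + 2 *: (v ** (u ** u)))) by rewrite /b; lmod.
have lL : L (v ** v + 2 *: (v ** (u ** u))).
  by apply: lyubichD; [|apply: lyubichZ]; apply: lyubichVV.
(* Up to sign b is 2vu + l with l in L; l kills U, and (vu)(vu) = 0. *)
have bb : b ** b = 0.
  have [lU l0] := lL.
  rewrite bE mulNl mulNr opprK; move: lU lL l0; set l := v ** v + _ => lU lL l0.
  rewrite mulDl l0; last by apply: peirceUD => //; apply: peirceUZ; apply: mulVU.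
  rewrite mulDr (lyubichUl l) //; last by apply: peirceUZ; apply: mulVU.
  by rewrite !mulE mulUV_UV0 // !scaler0 !addr0.
have bU : U b.
  rewrite bE -scaleN1r; apply: peirceUZ; apply: peirceUD; last by case: lL.
  by apply: peirceUZ; apply: mulVU.
have [k nil] := train_kernel_nil _ (train x x1).
have [S0 S_lin S_mul] := generated_subalgebraP x.
have xS : generated_subalgebra mul x x by apply: sub_gen_smallest.
exists k; have := nil (v + b); rewrite ppow_VU // => <-.
- by congr (iter _ _ _); rewrite /b !mulE; lmod.
- rewrite -vbE addrC -scaleN1r; apply: (S_lin) => //; exact: S_mul.
- by rewrite -vbE /weight_kernel /= linearB /= omegaM x1 mulr1 subrr.
Qed.

Lemma locally_train_nilpotentU v : locally_train_algebra mul omega ->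
  V v -> locally_nilpotent U (mul v).
Proof.
move=> train vV u uU.
have [k1] := locally_train_iter u v train uU vV.
have [k2] := locally_train_iter ((-1) *: u) v train (peirceUZ (-1) u uU) vV.
move/(iter_mul_eq0 k2 (k1 + k2)) => /(_ (leq_addl _ _)).
set y2 := (X in iter _ _ X) => y2_0.
move/(iter_mul_eq0 k1 (k1 + k2)) => /(_ (leq_addr _ _)).
set y1 := (X in iter _ _ X) => y1_0.
(* The vectors for u and -u differ by 8 L_v^2(u): this explains the two extra iterations and the
   three divisions by 2. *)
exists (k1 + k2).+2; do 3!apply: mulrn2_inj.
have <- : iter (k1 + k2) (mul v) ((-1) *: y1 + y2) = 0.
  by rewrite iter_mul_linear y1_0 y2_0 scaler0 addr0.
have -> : (-1) *: y1 + y2 = 8 *: (v ** (v ** u)) + 0.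
  by rewrite /y1 /y2 !mulE; lmod.
by rewrite iter_mul_linear iter_mul0 addr0 scaler_nat -!iterSr -!mulrnA.
Qed.

(** * From nilpotency on L to nilpotency on N *)

(** By trilinearity and cyclic symmetry four Peirce types remain. UUU gives 0; UUV reduces to (ab)p,
    in V^2; UVV reduces to q(pa) + p(qa), which kills U by antisymmetry; VVV lies in V V^2. *)
Lemma lyubich_cyclic x y z : N x -> N y -> N z ->
  L (x ** y ** z + y ** z ** x + z ** x ** y).
Proof.
move=> /peirce_decomposition[a [p [aU pV ->]]].
move=> /peirce_decomposition[b [q [bU qV ->]]].
move=> /peirce_decomposition[c [r [cU rV ->]]].
pose cyclic x' y' z' := x' ** y' ** z' + y' ** z' ** x' + z' ** x' ** y'.
rewrite -/(cyclic (a + p) (b + q) (c + r)).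
have rot x' y' z' : cyclic x' y' z' = cyclic y' z' x'.
  by rewrite /cyclic; lmod.
have cyclicD x' x'' y' z' : cyclic (x' + x'') y' z' = cyclic x' y' z' + cyclic x'' y' z'.
  by rewrite /cyclic !mulE; lmod.
have UUU a' b' c' : U a' -> U b' -> U c' -> L (cyclic a' b' c').
  move=> a'U b'U c'U; suff -> : cyclic a' b' c' = 0 by exact: lyubich0.
  rewrite -(mulU_UU a' b' c') // /cyclic.
  by rewrite (mulC (a' ** b')) (mulC (b' ** c')) (mulC (c' ** a')) (mulC c' a'); lmod.
have UUV a' b' p' : U a' -> U b' -> V p' -> L (cyclic a' b' p').
  move=> a'U b'U p'V; have -> : cyclic a' b' p' = a' ** b' ** p'.
    rewrite /cyclic (mulC _ a') (mulC b' p') mulU_UV //; lmod.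
  by apply: lyubichVV => //; apply: mulUU.
have UVV a' p' q' : U a' -> V p' -> V q' -> L (cyclic a' p' q').
  move=> a'U p'V q'V.
  have -> : cyclic a' p' q' = q' ** (p' ** a') + p' ** (q' ** a').
    rewrite /cyclic (mulC (p' ** q')) mulU_VV // (mulC _ q') (mulC a' p') (mulC (q' ** a')).
    by lmod.
  split=> [|u uU]; first by apply: peirceUD; apply: mulVU => //; apply: mulVU.
  have [p'a'U q'a'U] : U (p' ** a') /\ U (q' ** a') by split; apply: mulVU.
  rewrite mulC mulDr (mulU_UV u (p' ** a')) // (mulU_UV u (q' ** a')) //.
  by rewrite mulUV_UV // opprK subrr.
have VVV p' q' r' : V p' -> V q' -> V r' -> L (cyclic p' q' r').
  move=> p'V q'V r'V; rewrite /cyclic.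
  by apply: lyubichD; first apply: lyubichD; rewrite mulC; apply: lyubichVl => //;
    apply: lyubichVV.
clearbody cyclic.
rewrite cyclicD !(rot _ (b + q)) !cyclicD !(rot _ (c + r)) !cyclicD.
have UVU a' p' b' : U a' -> V p' -> U b' -> L (cyclic a' p' b').
  by move=> *; rewrite 2!rot; apply: UUV.
have VUU p' a' b' : V p' -> U a' -> U b' -> L (cyclic p' a' b').
  by move=> *; rewrite rot; apply: UUV.
have VUV p' a' q' : V p' -> U a' -> V q' -> L (cyclic p' a' q').
  by move=> *; rewrite rot; apply: UVV.
have VVU p' q' a' : V p' -> V q' -> U a' -> L (cyclic p' q' a').
  by move=> *; rewrite 2!rot; apply: UVV.
by do 3!apply: lyubichD; auto.
Qed.

(** The cyclic sum of (x, x, x) is 3x^3, so x^3 lies in L. With S for cyclic sums, 4 L_x^3(y) = S(x,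
    x, xy) + x S(x, x, y) - S(x, x^2, y) + y x^3. *)
Lemma lyubich_cube x y : N x -> N y -> L (x ** (x ** (x ** y))).
Proof.
move=> xN yN; have KM := weight_kernelM.
have four_neq0 : 4%:R != 0 :> K by rewrite (natrM _ 2 2) mulf_neq0.
have lin k l l' : L l -> L l' -> L (l + k *: l').
  by move=> lL l'L; apply: lyubichD => //; apply: lyubichZ.
pose D := x ** (x ** (x ** y)).
have xxxL : L (x ** (x ** x)).
  have -> : x ** (x ** x) = 3%:R^-1 *: (x ** x ** x + x ** x ** x + x ** x ** x).
    by rewrite (mulC (x ** x)) -mulr2n -mulrSr -scaler_nat scalerA mulVf ?scale1r.
  by apply: lyubichZ; apply: lyubich_cyclic.
have L1 := lyubich_cyclic x (x ** x) y xN (KM x x xN) yN.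
have L2 := lyubich_cyclic x x (x ** y) xN xN (KM x y xN).
have L3 := lyubich_kernell _ _ (lyubich_cyclic x x y xN xN yN) xN.
have L4 := lyubich_kernell _ _ xxxL yN.
rewrite -/D -[D]scale1r -(mulVf four_neq0) -scalerA; apply: lyubichZ.
have -> : 4 *: D = 1 *: (x ** x ** (x ** y) + x ** (x ** y) ** x + x ** y ** x ** x)
  + 1 *: (x ** (x ** x ** y + x ** y ** x + y ** x ** x))
  - (x ** (x ** x) ** y + x ** x ** y ** x + y ** x ** (x ** x))
  + y ** (x ** (x ** x)).
  rewrite /D !mulE (mulC y x) (mulC (x ** y) x) (mulC (x ** (x ** y)) x).
  rewrite (mulC (x ** x ** y) x) (mulC (x ** y) (x ** x)).
  by rewrite (mulC y (x ** (x ** x))); lmod.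
apply: lyubichD => //; rewrite addrC -[- (_ + _)]scaleN1r addrC.
by apply: (lin) => //; apply: (lin) => //; rewrite scale1r.
Qed.

Lemma lyubich_nilpotent_kernel x :
    (forall v, V v -> locally_nilpotent L (mul v)) ->
  N x -> locally_nilpotent N (mul x).
Proof.
move=> nilL xN y yN; have cubeL := lyubich_cube x y xN yN.
have [u [v [uU vV xE]]] := peirce_decomposition x xN.
have [k nil] := nilL v vV _ cubeL; exists (k + 3)%N.
rewrite iterD -[RHS]nil -[iter 3 _ _]/(x ** (x ** (x ** y))).
elim: k {nil} => //= k ->.
by rewrite {1}xE mulDl lyubichUl ?add0r //; apply: iter_mulL.
Qed.

(** * From nilpotency on N to train equations *)

(** Left side of a train equation of degree r with its leading coefficient [c 0] included, which
    keeps multiplication by a linear factor uniform. All exponents r - i are positive. *)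
Let train_form (c : nat -> K) r y :=
  \sum_(i < r) (c i * omega y ^+ i) *: ppow mul y (r - i)%N.

(* Multiplies the train polynomial by [X - k]. *)
Lemma train_form_step k c r : (0 < r)%N -> c 0%N = 1 ->
  exists2 c', c' 0%N = 1 & forall y,
    train_form c' r.+1 y = train_form c r y ** y - (k * omega y) *: train_form c r y.
Proof.
move=> r_gt0 c0.
(* The new coefficients are c_i - k c_(i-1); the test cuts off the values of [c] from r on, which
   are arbitrary. *)
exists (fun i => (if (i < r)%N then c i else 0) - (if i is j.+1 then k * c j else 0)).
  by rewrite r_gt0 subr0.
move=> y; rewrite /train_form.
under eq_bigr do rewrite mulrBl scalerBl.
rewrite sumrB; congr (_ - _).
- rewrite big_ord_recr /= ltnn mul0r scale0r addr0 linear_sumlz; apply: eq_bigr => i _.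
  by rewrite ltn_ord /= mulZl subSn 1?ltnW // -(subnSK (ltn_ord i)).
- rewrite big_ord_recl /= mul0r scale0r add0r scaler_sumr; apply: eq_bigr => i _.
  by rewrite scalerA subSS exprS; congr (_ *: _); ring.
Qed.

(** Realizes X^2 (X - 1)(X - 1/2)^j, starting from X and multiplying by X - 1, by X, then j times by
    X - 1/2. *)
Lemma train_form_half j : exists2 c, c 0%N = 1 & forall y,
  train_form c j.+3 y =
  iter j (fun z => z ** y - (2^-1 * omega y) *: z) ((y ** y - omega y *: y) ** y).
Proof.
elim: j => [|j [c c0 cE]].
- have [c1 c10 c1E] := train_form_step 1 (fun=> 1) 1%N isT erefl.
  have [c2 c20 c2E] := train_form_step 0 c1 2%N isT c10.
  exists c2 => // y; rewrite c2E c1E /train_form big_ord1 /=.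
  by rewrite mul0r scale0r subr0 expr0 !mul1r scale1r.
- have [c' c'0 c'E] := train_form_step 2^-1 c j.+3 isT c0.
  by exists c' => // y; rewrite c'E cE.
Qed.

Lemma train_form_eq0 c r S : (2 <= r)%N -> c 0%N = 1 ->
  (forall y, S y -> train_form c r y = 0) -> train_algebra mul omega S.
Proof.
move=> r_ge2 c0 formS; exists r, c; split=> // y /formS form0; rewrite -[RHS]form0.
rewrite /train_form -(big_mkord xpredT (fun i => (c i * omega y ^+ i) *: ppow mul y (r - i))).
by rewrite big_ltn 1?ltnW //= c0 expr0 mul1r scale1r subn0.
Qed.

Lemma train_generated x :
    (forall x, N x -> locally_nilpotent N (mul x)) ->
  omega x = 1 -> x ** x = e -> train_algebra mul omega (generated_subalgebra mul x).
Proof.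
move=> nilN x1 xx.
have xeN : N (x - e).
  by rewrite /weight_kernel /= linearB /= x1 omega_idempotent subrr.
have [u [v [uU vV xE]]] := peirce_decomposition _ xeN.
have {}xE : x = e + u + v by rewrite -addrA -xE addrC subrK.
(* This is x^2 = e expanded. The summand u^2 lies in V and the rest in U, so each vanishes. *)
have sq0 : u ** u + (u + (v ** v + 2 *: (v ** u))) = 0.
  have eu0 : e ** u *+ 2 - u = 0 by rewrite uU subrr.
  rewrite -[RHS]subr0 -{2}eu0 -(subrr e) -{1}xx xE !mulE (mulC u e) (mulC v e).
  by rewrite ee vV (mulC u v); lmod.
have vvL : L (v ** v) by apply: lyubichVV.
have vvuL : L (v ** (v ** u)) by apply: lyubich_sqrV.
have uE : u = (-1) *: (v ** v + 2 *: (v ** u)).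
  have sqU : u ** u = 0.
    apply: peirce_disjoint; last exact: mulUU.
    have -> : u ** u = (-1) *: (u + (v ** v + 2 *: (v ** u))).
      by apply/eqP; rewrite -subr_eq0 -[X in _ == X]sq0; apply/eqP; lmod.
    apply/peirceUZ/peirceUD => //; apply: peirceUD; first by case: vvL.
    by apply/peirceUZ/mulVU.
  by apply/eqP; rewrite -subr_eq0 -[X in _ == X]sq0 sqU; apply/eqP; lmod.
have uL : L u.
  (* Substituting u = -v^2 - 2vu into itself expresses u through L_v^2(u), v v^2 and v^2, all in
     L. *)
  have -> : u = 4 *: (v ** (v ** u)) + (2 *: (v ** (v ** v)) + (-1) *: (v ** v)).
    by rewrite {1}uE {1}uE !mulE; lmod.
  apply: lyubichD; first exact: lyubichZ.
  by apply: lyubichD; apply: lyubichZ => //; apply: lyubichVl.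
have LN l : L l -> N l by case=> lU _; apply: peirceU_kernel.
have vN : N v by apply: peirceV_kernel.
have [k1 nil_u] := nilN v vN u (LN u uL).
have [k2 nil_vv] := nilN v vN (v ** v) (LN _ vvL).
pose m := (k1 + k2)%N.
pose M := [set l | L l /\ iter m (mul v) l = 0].
have uM : M u by split=> //; apply: iter_mul_eq0 nil_u; apply: leq_addr.
have vvM : M (v ** v) by split=> //; apply: iter_mul_eq0 nil_vv; apply: leq_addl.
have MD l l' k : M l -> M l' -> M (k *: l + l').
  move=> [lL l0] [l'L l'0]; split; first by apply: lyubichD => //; apply: lyubichZ.
  by rewrite iter_mul_linear l0 l'0 scaler0 addr0.
have M0 : M 0 by split; [apply: lyubich0 | apply: iter_mul0].
have MZ l k : M l -> M (k *: l) by move=> lM; rewrite -[_ *: _]addr0; apply: MD.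
have Mv l : M l -> M (v ** l).
  by move=> [lL l0]; split; [apply: lyubichVl | rewrite -iterSr iterS l0 mulx0].
have MeE l : M l -> e ** l = 2^-1 *: l by move=> [[lU _] _]; apply: peirceUE.
have MM l l' : M l -> M l' -> l ** l' = 0 by move=> [[_ l0] _] [[l'U _] _]; apply: l0.
have mulW a b l a' b' l' : M l -> M l' ->
    (a *: e + b *: v + l) ** (a' *: e + b' *: v + l') =
    (a * a') *: e + ((b * b') *: (v ** v) + ((a * 2^-1) *: l' + ((a' * 2^-1) *: l
      + (b *: (v ** l') + b' *: (v ** l))))).
  move=> lM l'M; rewrite !mulE (mulC v e) (mulC l e) (mulC l v) ee vV (MM l l') // !MeE //.
  by lmod.
(* Ke + Kv + M is closed under products because ev = 0, v^2 lies in M, M^2 = 0, and M is stable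
   under L_e and L_v. *)
pose W := [set y | exists a b l, M l /\ y = a *: e + b *: v + l].
have W_subalgebra : subalgebra mul W.
  split.
  - by exists 0, 0, 0; split => //; rewrite !scale0r !addr0.
  - move=> k _ _ [a [b [l [lM ->]]]] [a' [b' [l' [l'M ->]]]].
    exists (k * a + a'), (k * b + b'), (k *: l + l'); split; first exact: MD.
    by lmod.
  - move=> _ _ [a [b [l [lM ->]]]] [a' [b' [l' [l'M ->]]]].
    rewrite mulW //; eexists (a * a'), 0, _; split; last first.
      by rewrite scale0r addr0; reflexivity.
    by do 4![apply: (MD) => //]; [apply: Mv | apply/MZ/Mv].
have xW : W x by exists 1, 1, u; split=> //; rewrite !scale1r xE; lmod.
have [c c0 cE] := train_form_half m.
apply: (train_form_eq0 c m.+3) => // y yS.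
have [a [b [l [lM yE]]]] : W y.
  by apply: (yS W); split=> // _ ->.
have ya : omega y = a.
  rewrite yE !linearD /= !linearZ /= omega_idempotent vN LN ?mulr1 ?mulr0 ?addr0 //.
  by case: lM.
(* As y^2 has no v-component, y^2 - ay is -ab v plus an element of M; one more factor y moves it
   into M. *)
have zM : M ((y ** y - omega y *: y) ** y).
  have [l1 [l1M ->]] : exists l1, M l1 /\
      y ** y - omega y *: y = 0 *: e + (- (a * b)) *: v + l1.
    exists ((b * b) *: (v ** v) + (((a * 2^-1) *: l + ((a * 2^-1) *: l
      + (b *: (v ** l) + (b *: (v ** l) + (- a) *: l)))))).
    split; first by do 5![apply: (MD) => //; try exact: Mv]; apply: MZ.
    by rewrite {1 2}yE mulW // ya {1}yE; lmod.
  rewrite yE mulW // mul0r scale0r add0r.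
  by do 4![apply: (MD) => //; try exact: Mv]; apply/MZ/Mv.
rewrite cE; move: ((y ** y - _) ** y) zM => z zM.
(* On L the summand l of y acts as 0 and ae as a/2, so L_y - a/2 coincides with b L_v. *)
have -> k : iter k (fun z => z ** y - (2^-1 * omega y) *: z) z = b ^+ k *: iter k (mul v) z.
  elim: k => [|k IHk] /=; first by rewrite expr0 scale1r.
  rewrite IHk; have zkL : L (iter k (mul v) z) by apply: iter_mulL => //; case: zM.
  rewrite mulC yE !mulE peirceUE; last by case: zkL.
  rewrite (lyubichUl _ l zkL); last by case: lM => [[]].
  by rewrite -yE ya exprS; lmod.
by case: zM => _ ->; rewrite scaler0.
Qed.

End Peirce.
End BernsteinAlgebra.

Theorem theorem4p7 (K : fieldType) (A : lmodType K)
    (mul : {bilinear A -> A -> A}) (omega : {scalar A}) (e : A)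
    (K_infinite : infinite_set [set: K])
    (char_not2 : 2%N \notin [pchar K]) (char_not3 : 3%N \notin [pchar K])
    (A_bernstein : bernstein_algebra mul omega)
    (e_idempotent : nonzero_idempotent mul e) :
  [<-> locally_train_algebra mul omega;
       forall v, peirceV mul e v -> locally_nilpotent (peirceU mul e) (mul v);
       forall v, peirceV mul e v ->
         locally_nilpotent (lyubich_ideal mul e) (mul v);
       forall x, weight_kernel omega x ->
         locally_nilpotent (weight_kernel omega) (mul x)].
Proof.
tfae.
- by move=> train v vV; apply: (locally_train_nilpotentU _ _ _ _ char_not2 char_not3
    A_bernstein _ e_idempotent).
- by move=> nilU v vV l [lU _]; apply: nilU.
- by move=> nilL x xN; apply: (lyubich_nilpotent_kernel _ _ _ _ char_not2 char_not3
    A_bernstein _ e_idempotent).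
- move=> nilN x x1; have [_ [_ omegaM] bernstein] := A_bernstein.
  (* Condition (iv) does not mention e, so the Peirce decomposition may be taken with respect to
     x^2. *)
  have idem : nonzero_idempotent mul (mul x x).
    split; last by rewrite bernstein x1 expr1n scale1r.
    apply/eqP => xx0; have := omegaM x x; rewrite xx0 linear0 x1 mulr1 => /esym/eqP.
    by rewrite oner_eq0.
  exact: (train_generated _ _ _ _ char_not2 char_not3 A_bernstein _ idem).
Qed.
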